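(* Let $H$ be a Hilbert space, let $\mathbf{a}=[a_1,\dots,a_\ell]$ be a row and $\mathbf{b}=[b_1,\dots,b_\ell]^t$ a column of operators $a_j,b_j\in\mathcal{B}(H)$, and let $Tx=\sum_{j=1}^\ell a_jxb_j$ ($x\in\mathcal{B}(H)$). Then \[ \|T\|=\sup\left\{\operatorname{tgm}\big(Q(\mathbf{a}^*,\xi),Q(\mathbf{b},\eta)\big):\xi,\eta\in H,\ \|\xi\|=\|\eta\|=1\right\}. \]
   Context: For a column $\mathbf{c}=[c_1,\dots,c_\ell]^t$ of operators in $\mathcal{B}(H)$ and $\eta\in H$, $Q(\mathbf{c},\eta)=(\langle c_i^*c_j\eta,\eta\rangle)_{i,j=1}^\ell=(\langle c_j\eta,c_i\eta\rangle)_{i,j=1}^\ell\in M_\ell(\mathbb{C})$; $\mathbf{a}^*$ denotes the column $[a_1^*,\dots,a_\ell^*]^t$, so $Q(\mathbf{a}^*,\xi)=(\langle a_j^*\xi,a_i^*\xi\rangle)_{i,j=1}^\ell$. For positive semidefinite $\ell\times\ell$ matrices $X,Y$, the tracial geometric mean is $\operatorname{tgm}(X,Y)=\operatorname{trace}\sqrt{\sqrt{X}\,Y\sqrt{X}}$ (positive semidefinite square roots). $\|T\|$ is the operator norm of $T$ on $\mathcal{B}(H)$. *)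

(* Defs.v *)
(* + MathComp-Analysis (ereal_sup, xget) + real-closed (complex) *)
From HB Require Import structures.
From mathcomp Require Import all_boot all_order all_algebra.
From mathcomp Require Import complex.
From mathcomp Require Import boolp classical_sets reals constructive_ereal ereal.
Set Implicit Arguments. Unset Strict Implicit. Unset Printing Implicit Defensive.
Import Order.TTheory GRing.Theory Num.Theory.
Local Open Scope ring_scope.
Local Open Scope complex_scope.

Section HilbertDefs.
Variable R : realType.
Local Notation C := R[i].

(* A complex Hilbert space: a C-vector space V with an inner product
   <x,y> = ip x y, linear in the first argument and conjugate-linear in the
   second (the convention used in the paper: <c_i^* c_j eta, eta> = <c_j eta, c_i eta>),
   positive definite, and complete for the induced norm. *)
Variable V : lmodType C.
Variable ip : V -> V -> C.

Definition hnorm (x : V) : R := Num.sqrt (complex.Re (ip x x)).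

Definition is_hilbert : Prop :=
  [/\ (forall (c : C) (x y z : V), ip (c *: x + y) z = c * ip x z + ip y z),
      (forall x y : V, ip y x = (ip x y)^*),
      (forall x : V, 0 <= ip x x),
      (forall x : V, ip x x = 0 -> x = 0) &
      (forall u : nat -> V,
         (forall e : R, 0 < e -> exists N : nat, forall m n : nat,
              (N <= m)%N -> (N <= n)%N -> hnorm (u m - u n) < e) ->
         exists L : V, forall e : R, 0 < e -> exists N : nat, forall n : nat,
              (N <= n)%N -> hnorm (u n - L) < e)].

(* bounded linear operators on V, i.e. elements of B(H) *)
Definition bounded_op (f : V -> V) : Prop :=
  (forall (c : C) (x y : V), f (c *: x + y) = c *: f x + f y) /\
  exists M : R, forall x : V, hnorm (f x) <= M * hnorm x.

(* the Hilbert-space adjoint (unique when it exists, which it does for bounded f) *)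
Definition adj (f : V -> V) : V -> V :=
  xget f [set g : V -> V | forall x y : V, ip (f x) y = ip x (g y)].

(* operator norm on B(H) (extended-real valued supremum) *)
Definition opnorm (f : V -> V) : \bar R :=
  ereal_sup [set (hnorm (f v))%:E | v in [set v : V | hnorm v <= 1]].

(* Q(c, eta)_{ij} = <c_j eta, c_i eta> *)
Definition Qmx (l : nat) (c : 'I_l -> V -> V) (eta : V) : 'M[C]_l :=
  \matrix_(i < l, j < l) ip (c j eta) (c i eta).

End HilbertDefs.

Section MatrixDefs.
Variable R : realType.
Local Notation C := R[i].

Definition conjT (l : nat) (A : 'M[C]_l) : 'M[C]_l := (map_mx Num.conj A)^T.

Definition psd (l : nat) (X : 'M[C]_l) : Prop :=
  conjT X = X /\
  forall v : 'cV[C]_l, 0 <= ((map_mx Num.conj v)^T *m X *m v) ord0 ord0.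

(* the positive semidefinite square root of a PSD matrix *)
Definition psd_sqrt (l : nat) (X : 'M[C]_l) : 'M[C]_l :=
  xget 0 [set S : 'M[C]_l | psd S /\ S *m S = X].

(* tracial geometric mean tgm(X,Y) = trace sqrt(sqrt X Y sqrt X) (a real number) *)
Definition tgm (l : nat) (X Y : 'M[C]_l) : R :=
  complex.Re (\tr (psd_sqrt (psd_sqrt X *m Y *m psd_sqrt X))).

End MatrixDefs.

(* the elementary operator T x = sum_j a_j x b_j on B(H) *)
Definition elem_op (R : realType) (V : lmodType R[i]) (l : nat)
  (a b : 'I_l -> V -> V) (x : V -> V) : V -> V :=
  fun v => (\sum_(j < l) a j (x (b j v)))%R.

(* norm of T as an operator on B(H) *)
Definition elem_norm (R : realType) (V : lmodType R[i]) (ip : V -> V -> R[i])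
  (l : nat) (a b : 'I_l -> V -> V) : \bar R :=
  ereal_sup [set opnorm ip (elem_op a b x) | x in
             [set x : V -> V | bounded_op ip x /\ (opnorm ip x <= 1%:E)%E]].

(* Main.v *)
(* For unit vectors xi, eta, put u_j = a_j^* xi and v_j = b_j eta, so that
   <T x eta, xi> = sum_j <x v_j, u_j>, and it suffices to show that the supremum
   of Re sum_j <x v_j, u_j> over contractions x is tgm(G_u, G_v), where G
   denotes Gram matrices.  View families as operators from C^l to H, let
   P = sqrt(G_u) and let M be the square root of P G_v P = (v P)^*(v P), so that
   the tgm is tr M.  Polar decompositions u = W P and v P = F M turn the sum
   into tr(W^* x F M), whose real part is at most tr M because W, F and x are
   contractions, and which equals tr M for x = W F^*. *)
Require Import Defs.
From HB Require Import structures.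
From mathcomp Require Import all_boot all_order all_algebra.
From mathcomp Require Import complex.
From mathcomp Require Import boolp classical_sets reals constructive_ereal ereal.
From mathcomp Require Import spectral ring lra.
Import Order.TTheory GRing.Theory Num.Theory.
Set Implicit Arguments. Unset Strict Implicit.
Unset Printing Implicit Defensive.
Local Open Scope ring_scope.
Local Open Scope classical_set_scope.

Local Notation "A ^H" := ((map_mx Num.conj A)^T) (at level 8, format "A ^H").

(** * Conjugate transposes and spectral calculus for Hermitian matrices *)

Section Adjoint.
Variable C : numClosedFieldType.

Lemma adjmxK m n (A : 'M[C]_(m, n)) : A^H^H = A.
Proof. by apply/matrixP => i j; rewrite !mxE conjCK. Qed.

Lemma adjmxM m n p (A : 'M[C]_(m, n)) (B : 'M[C]_(n, p)) :
  (A *m B)^H = B^H *m A^H.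
Proof. by rewrite map_mxM trmx_mul. Qed.

Lemma adjmxB m n (A B : 'M[C]_(m, n)) : (A - B)^H = A^H - B^H.
Proof. by rewrite map_mxB linearB. Qed.

Lemma adjmx1 n : (1%:M : 'M[C]_n)^H = 1%:M.
Proof. by rewrite map_mx1 trmx1. Qed.

Lemma adjmx_mulE m n (A : 'M[C]_(m, n)) i j :
  (A^H *m A) i j = \sum_k A k j * (A k i)^*.
Proof. by rewrite mxE; apply: eq_bigr => k _; rewrite !mxE mulrC. Qed.

Lemma adjmx_mul_diag_ge0 m n (A : 'M[C]_(m, n)) i : 0 <= (A^H *m A) i i.
Proof. by rewrite adjmx_mulE sumr_ge0 // => k _; rewrite mul_conjC_ge0. Qed.

Lemma adjmx_mul_eq0 m n (A : 'M[C]_(m, n)) : A^H *m A = 0 -> A = 0.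
Proof.
move=> A0; apply/matrixP => k j; rewrite [RHS]mxE.
have /eqP := congr1 (fun M : 'M_n => M j j) A0.
rewrite adjmx_mulE mxE psumr_eq0; last by move=> ? _; rewrite mul_conjC_ge0.
by move=> /allP/(_ k); rewrite mem_index_enum mul_conjC_eq0 => /(_ isT)/eqP.
Qed.

Lemma herm_spectral n (A : 'M[C]_n) : A^H = A ->
  exists (U : 'M[C]_n) (d : 'rV[C]_n),
    [/\ U *m U^H = 1%:M, U^H *m U = 1%:M & A = U^H *m diag_mx d *m U].
Proof.
move=> hA; have /hermitian_normalmx/orthomx_spectralP AE : A \is hermsymmx.
  by apply/is_hermitianmxP; rewrite expr0 scale1r -map_trmx hA.
have Uu := spectral_unitarymx A; have /unitarymxP UU := Uu.
rewrite invmx_unitary // -map_trmx in AE; rewrite -map_trmx in UU.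
by exists (spectralmx A), (spectral_diag A); split=> //; apply: mulmx1C.
Qed.

(** [Q] is the Moore-Penrose inverse of [P]: eigenvalues are inverted in an orthonormal eigenbasis,
    and the convention [0^-1 = 0] takes care of the kernel. It allows polar decompositions with a
    singular [P]. *)
Lemma herm_pinv_exists n (P : 'M[C]_n) : P^H = P ->
  exists Q : 'M[C]_n, [/\ Q^H = Q, P *m Q = Q *m P & P *m Q *m P = P].
Proof.
move=> hP; have [U [d [UU1 UU2 PE]]] := herm_spectral hP.
pose conjU D := U^H *m D *m U.
have conjUM D E : conjU D *m conjU E = conjU (D *m E).
  by rewrite /conjU !mulmxA -[_ *m U *m U^H]mulmxA UU1 mulmx1.
have conjU_adj D : (conjU D)^H = conjU D^H.
  by rewrite /conjU !adjmxM adjmxK mulmxA.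
(* Conjugating [P^H = P] by [U] leaves an equality of diagonal matrices. *)
have d_real i : (d 0 i)^* = d 0 i.
  have /(congr1 (fun A => U *m A *m U^H)) := hP.
  rewrite {1 2}PE -/(conjU _) conjU_adj /conjU !mulmxA UU1 mul1mx.
  rewrite -!mulmxA UU1 !mulmx1 mul1mx => /matrixP/(_ i i).
  by rewrite map_diag_mx tr_diag_mx !mxE eqxx.
exists (conjU (diag_mx (\row_i (d 0 i)^-1))); rewrite PE -/(conjU _).
rewrite conjU_adj !conjUM !mulmx_diag; split; congr conjU; last 2 first.
- by congr diag_mx; apply/rowP => i; rewrite !mxE mulrC.
- by congr diag_mx; apply/rowP => i; rewrite !mxE;
  have [->|d0] := eqVneq (d 0 i) 0; rewrite ?mulr0 ?divff ?mul1r.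
rewrite map_diag_mx tr_diag_mx; congr diag_mx; apply/rowP => i.
by rewrite !mxE fmorphV; congr (_^-1); apply: d_real.
Qed.

End Adjoint.

(** * Positive semidefinite matrices and their square roots *)

Section Psd.
Variable R : realType.
Local Notation C := R[i].

Lemma adjmx_mul_psd m n (A : 'M[C]_(m, n)) : psd (A^H *m A).
Proof.
split=> [|v]; first by rewrite /conjT adjmxM adjmxK.
by rewrite mulmxA -mulmxA -adjmxM adjmx_mul_diag_ge0.
Qed.

Lemma psd_herm n (X : 'M[C]_n) : psd X -> X^H = X.
Proof. by case. Qed.

Lemma psd_sqrt_exists n (X : 'M[C]_n) : psd X ->
  exists S : 'M[C]_n, psd S /\ S *m S = X.
Proof.
move=> [hX pX]; have [U [d [UU1 UU2 XE]]] := herm_spectral hX.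
have d_ge0 i : 0 <= d 0 i.
  (* At the eigenvector in column [i] of [U^H], the quadratic form of [X] takes the value
     [d 0 i]. *)
  have := pX (U^H *m delta_mx i 0); rewrite -/(_^H) adjmxM adjmxK XE !mulmxA.
  rewrite -[_ *m U *m U^H]mulmxA UU1 mulmx1 -[_ *m U *m U^H]mulmxA UU1 mulmx1.
  by rewrite map_delta_mx trmx_delta -rowE -colE !mxE eqxx.
(* Fourth roots are taken so that the square root of [X] has the form [A^H *m A] with [A = D *m U],
   which makes it positive at once. *)
pose D := diag_mx (\row_i sqrtC (sqrtC (d 0 i))).
have hD : D^H = D.
  rewrite /D map_diag_mx tr_diag_mx; congr diag_mx; apply/rowP => i.
  by rewrite !mxE; apply: geC0_conj; rewrite !sqrtC_ge0.
have D4 : D *m D *m D *m D = diag_mx d.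
  rewrite !mulmx_diag; congr diag_mx; apply/rowP => i; rewrite !mxE.
  by rewrite -expr2 sqrtCK -mulrA -expr2 sqrtCK -expr2 sqrtCK.
exists ((D *m U)^H *m (D *m U)); split; first exact: adjmx_mul_psd.
by rewrite XE adjmxM hD !mulmxA -[_ *m U *m U^H]mulmxA UU1 mulmx1 -D4 !mulmxA.
Qed.

Lemma psd_sqrtP n (X : 'M[C]_n) : psd X ->
  psd (psd_sqrt X) /\ psd_sqrt X *m psd_sqrt X = X.
Proof. by move=> /psd_sqrt_exists; apply: xgetPex. Qed.

Lemma psd_tr_ge0 n (X : 'M[C]_n) : psd X -> 0 <= \tr X.
Proof.
move=> /psd_sqrt_exists [S [[hS _] <-]].
by apply: sumr_ge0 => i _; rewrite -{1}hS adjmx_mul_diag_ge0.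
Qed.

End Psd.

(** * Real parts and linear maps *)

Lemma ReD (R : realType) (x y : R[i]) :
  complex.Re (x + y) = complex.Re x + complex.Re y.
Proof. by case: x; case: y. Qed.

Lemma ReN (R : realType) (x : R[i]) : complex.Re (- x) = - complex.Re x.
Proof. by case: x. Qed.

Lemma ReZ (R : realType) (t : R) (x : R[i]) :
  complex.Re (real_complex R t * x) = t * complex.Re x.
Proof. by case: x => a b /=; rewrite mul0r subr0. Qed.

Lemma Re_conj (R : realType) (x : R[i]) : complex.Re x^* = complex.Re x.
Proof. by case: x. Qed.

Lemma conj_real_complex (R : realType) (t : R) :
  (real_complex R t)^* = real_complex R t.
Proof. exact: conjc_real. Qed.

Lemma Re_le (R : realType) (x y : R[i]) :
  x <= y -> complex.Re x <= complex.Re y.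
Proof. by rewrite lecE => /andP[]. Qed.

Lemma Re_sum (R : realType) (I : finType) (F : I -> R[i]) :
  complex.Re (\sum_i F i) = \sum_i complex.Re (F i).
Proof. by apply: (big_morph (@complex.Re R)) => [x y|]; rewrite ?ReD. Qed.

Section LinearMaps.
Variables (R : realType) (V W : lmodType R[i]).
Implicit Types x : V -> W.

(** This is the linearity clause of [bounded_op], so the first component of a boundedness proof
    serves as a proof of [linop]. Separate source and target spaces let it cover functionals as
    well. *)
Definition linop x :=
  forall (c : R[i]) u v, x (c *: u + v) = c *: x u + x v.

Lemma linop0 x : linop x -> x 0 = 0.
Proof.
by move=> xL; have := xL (-1) 0 0; rewrite scaler0 addr0 scaleN1r addNr.
Qed.

Lemma linopZ x : linop x -> forall c u, x (c *: u) = c *: x u.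
Proof. by move=> xL c u; rewrite -[c *: u]addr0 xL linop0 // addr0. Qed.

Lemma linopD x : linop x -> forall u v, x (u + v) = x u + x v.
Proof. by move=> xL u v; rewrite -[u in LHS]scale1r xL scale1r. Qed.

End LinearMaps.

(** * Inner product geometry, Riesz representation and adjoints *)

Section InnerProduct.
Variables (R : realType) (V : lmodType R[i]) (ip : V -> V -> R[i]).
Hypothesis HV : is_hilbert ip.
Local Notation C := R[i].
Local Notation "t %:C" := (real_complex R t).
Local Notation "'[ x , y ]" := (ip x y).
Local Notation re x y := (complex.Re (ip x y)).
Local Notation norm := (hnorm ip).

Lemma ipC x y : '[y, x] = '[x, y]^*.
Proof. by case: HV. Qed.

Lemma ipDl x y z : '[x + y, z] = '[x, z] + '[y, z].
Proof. by case: HV => H _ _ _ _; rewrite -[x in LHS]scale1r H mul1r. Qed.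

Lemma ip0l z : '[0, z] = 0.
Proof. by apply: (addrI '[0, z]); rewrite -ipDl !addr0. Qed.

Lemma ipZl c x z : '[c *: x, z] = c * '[x, z].
Proof. by case: HV => H _ _ _ _; rewrite -[c *: x]addr0 H ip0l addr0. Qed.

Lemma ipDr x y z : '[z, x + y] = '[z, x] + '[z, y].
Proof. by rewrite !(ipC _ z) ipDl rmorphD. Qed.

Lemma ip0r z : '[z, 0] = 0.
Proof. by rewrite ipC ip0l rmorph0. Qed.

Lemma ipZr c x z : '[z, c *: x] = c^* * '[z, x].
Proof. by rewrite !(ipC _ z) ipZl rmorphM. Qed.

Lemma ipNl x z : '[- x, z] = - '[x, z].
Proof. by rewrite -scaleN1r ipZl mulN1r. Qed.

Lemma ip_suml (I : finType) (F : I -> V) z :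
  '[\sum_i F i, z] = \sum_i '[F i, z].
Proof.
exact: (big_morph (fun x => '[x, z]) (fun x y => ipDl x y z) (ip0l z)).
Qed.

Lemma ip_ge0 x : 0 <= '[x, x].
Proof. by case: HV. Qed.

Lemma ip_eq0 x : '[x, x] = 0 -> x = 0.
Proof. by case: HV => _ _ _ H _; apply: H. Qed.

Lemma hnorm_ge0 x : 0 <= norm x.
Proof. exact: sqrtr_ge0. Qed.

Lemma sqr_hnorm x : norm x ^+ 2 = re x x.
Proof. by rewrite sqr_sqrtr //; have := Re_le (ip_ge0 x). Qed.

Lemma ipxxE x : '[x, x] = (norm x ^+ 2)%:C.
Proof.
rewrite sqr_hnorm; have := ger0_Im (ip_ge0 x).
by case: '[x, x] => a b /= ->.
Qed.

Lemma hnorm_eq0 x : norm x = 0 -> x = 0.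
Proof. by move=> x0; apply: ip_eq0; rewrite ipxxE x0 expr0n. Qed.

Lemma hnorm0 : norm 0 = 0.
Proof. by rewrite /hnorm ip0l sqrtr0. Qed.

Lemma hnormZ (t : R) x : norm (t%:C *: x) = `|t| * norm x.
Proof.
rewrite /hnorm ipZl ipZr conj_real_complex !ReZ mulrA -expr2.
by rewrite sqrtrM ?sqr_ge0 // sqrtr_sqr.
Qed.

Lemma reC x y : re y x = re x y.
Proof. by rewrite ipC Re_conj. Qed.

Lemma reZl (t : R) x y : re (t%:C *: x) y = t * re x y.
Proof. by rewrite ipZl ReZ. Qed.

Lemma sqr_hnormDZ (t : R) x y :
  norm (x + t%:C *: y) ^+ 2 =
  norm x ^+ 2 + 2 * t * re x y + t ^+ 2 * norm y ^+ 2.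
Proof.
rewrite !sqr_hnorm ipDl !ipDr !ReD !reZl (reC (t%:C *: y) x).
by rewrite (reC (t%:C *: y) y) !reZl (reC x y); ring.
Qed.

Lemma re_amgm x y : 2 * re x y <= norm x ^+ 2 + norm y ^+ 2.
Proof.
by have := sqr_ge0 (norm (x + (- 1)%:C *: y)); rewrite sqr_hnormDZ; lra.
Qed.

Lemma re_cauchy x y : re x y <= norm x * norm y.
Proof.
have [x0|x0] := eqVneq (norm x) 0.
  by rewrite (hnorm_eq0 x0) ip0l hnorm0 mul0r.
have [y0|y0] := eqVneq (norm y) 0.
  by rewrite (hnorm_eq0 y0) ip0r hnorm0 mulr0.
have xp : 0 < norm x by rewrite lt_def x0 hnorm_ge0.
have yp : 0 < norm y by rewrite lt_def y0 hnorm_ge0.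
(* Rescaling gives both vectors the norm [norm x * norm y], where the arithmetic-geometric bound
   becomes Cauchy-Schwarz. *)
have := re_amgm ((norm y)%:C *: x) ((norm x)%:C *: y).
rewrite !hnormZ !ger0_norm ?hnorm_ge0 // reZl reC reZl reC => H.
rewrite -(ler_pM2l (mulr_gt0 xp yp)); nra.
Qed.

(* Riesz: the minimiser L of |x|^2 - 2 Re (phi x) represents phi.  A minimising
   sequence is Cauchy by the parallelogram identity. *)
Lemma riesz (phi : V -> C^o) (K : R) : linop phi ->
  (forall x, 2 * complex.Re (phi x) <= norm x ^+ 2 + K) ->
  exists L, forall x, phi x = '[x, L].
Proof.
move=> phiL phiB; case: (HV) => _ _ _ _ complete.
pose J x := norm x ^+ 2 - 2 * complex.Re (phi x).
have phiD x (t : R) y : complex.Re (phi (x + t%:C *: y)) =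
    complex.Re (phi x) + t * complex.Re (phi y).
  by rewrite addrC phiL ReD ReZ addrC.
have JD x t y : J (x + t%:C *: y) =
    J x + 2 * t * (re x y - complex.Re (phi y)) + t ^+ 2 * norm y ^+ 2.
  by rewrite /J sqr_hnormDZ phiD; ring.
pose E := range (fun x => - J x).
have supE : has_sup E.
  split; first by exists (- J 0), 0.
  by exists K => _ [x _ <-]; rewrite /J; have := phiB x; lra.
pose m := - sup E.
have mJ x : m <= J x.
  by rewrite /m lerNl; apply: ub_le_sup => //; [case: supE | exists x].
have approx (n : nat) : exists x, J x < m + n.+1%:R^-1.
  have n0 : 0 < n.+1%:R^-1 :> R by rewrite invr_gt0.
  have [_ [x _ <-] Hx] := sup_adherent n0 supE.
  by exists x; rewrite /m; move: (n.+1%:R^-1) Hx => e Hx; lra.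
have [u uP] := choice approx.
have near (n k : nat) :
    norm (u n - u k) ^+ 2 <= 2 * n.+1%:R^-1 + 2 * k.+1%:R^-1.
  (* At the midpoint, [J] is the mean of [J (u n)] and [J (u k)] minus a quarter of the squared
     distance; this value is still at least [m]. *)
  have := mJ (u k + 2^-1%:C *: (u n - u k)); rewrite JD.
  have := JD (u k) 1 (u n - u k); rewrite scale1r [u k + _]addrC subrK.
  have := uP n; have := uP k.
  by move: (n.+1%:R^-1) (k.+1%:R^-1) (re _ _) (norm _) => *; lra.
have [L HL] : exists L, forall e : R, 0 < e -> exists N : nat, forall n : nat,
    (N <= n)%N -> norm (u n - L) < e.
  apply: complete => e e0.
  have [N] := ltr_add_invr (divr_gt0 (exprn_gt0 2 e0) (ltr0n R 4)).
  rewrite add0r => HN; exists N => n k Nn Nk.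
  rewrite -(ltr_sqr (hnorm_ge0 _) (ltW e0)); apply: le_lt_trans (near n k) _.
  have inv_le i : (N <= i)%N -> i.+1%:R^-1 <= N.+1%:R^-1 :> R.
    by move=> Ni; rewrite lef_pV2 ?posrE ?ltr0n // ler_nat.
  have := inv_le _ Nn; have := inv_le _ Nk.
  by move: (n.+1%:R^-1) (k.+1%:R^-1) (N.+1%:R^-1) HN => *; lra.
have reL h : re L h = complex.Re (phi h).
  apply/eqP; rewrite -subr_eq0; apply/eqP.
  set d := _ - _; set b := norm h ^+ 2.
  have b0 : 0 <= b by apply: sqr_ge0.
  (* Minimality of [L] in the direction [h], obtained up to [e] from the almost minimal [u n]: half
     of [e] pays for [J (u n) - m], the other half for replacing [u n] by [L] in the inner
     product. *)
  have quad t : 0 <= 2 * t * d + t ^+ 2 * b.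
    apply/ler_addgt0Pr => e e0.
    pose c := 2 * `|t| * norm h.
    have c0 : 0 <= c by rewrite !mulr_ge0 ?hnorm_ge0.
    have e2 : 0 < e / 2 by rewrite divr_gt0.
    have [N1] := ltr_add_invr e2; rewrite add0r => HN1.
    have [N2 HN2] := HL (e / 2 / (c + 1)) (divr_gt0 e2 (ltr_wpDl c0 ltr01)).
    pose n := maxn N1 N2.
    have un : n.+1%:R^-1 < e / 2.
      apply: le_lt_trans HN1.
      by rewrite lef_pV2 ?posrE ?ltr0n // ler_nat ltnS leq_maxl.
    have := HN2 n (leq_maxr _ _); rewrite ltr_pdivlMr; last by rewrite ltr_wpDl.
    have := mJ (u n + t%:C *: h); rewrite JD -/b.
    have := uP n.
    have unE : 2 * t * re (u n) h =
        2 * t * re L h + 2 * re (u n - L) (t%:C *: h).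
      by rewrite (reC (t%:C *: h)) reZl (reC (u n - L)) ipDl ipNl ReD ReN; ring.
    have := re_cauchy (u n - L) (t%:C *: h); rewrite hnormZ.
    have := hnorm_ge0 (u n - L).
    move: unE un; rewrite /d /c.
    move: (n.+1%:R^-1) (re (u n) h) (re (u n - L) _) (norm (u n - L)) => *.
    by nra.
  (* A negative value unless [d = 0]; the denominator [b + 1] instead of the optimal [b] stays
     nonzero when [h = 0]. *)
  have := quad (- d / (b + 1)).
  have -> : 2 * (- d / (b + 1)) * d + (- d / (b + 1)) ^+ 2 * b =
      - (d ^+ 2 * ((b + 2) / (b + 1) ^+ 2)).
    by field; rewrite gt_eqF // ltr_wpDl.
  rewrite oppr_ge0 pmulr_lle0; last by rewrite divr_gt0 ?exprn_gt0 ?ltr_wpDl.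
  by move=> d2; apply/eqP; rewrite -sqrf_eq0 eq_le d2 sqr_ge0.
exists L => x.
(* Real parts at ['i *: x] supply the imaginary parts at [x]. *)
have := reL x; have := reL ('i%C *: x); rewrite (linopZ phiL).
rewrite !(reC _ L) ipZl.
case: (phi x) => a1 b1; case: '[x, L] => a2 b2 /=.
by rewrite !mul0r !mul1r !sub0r => /oppr_inj -> ->.
Qed.

(** Riesz representation for each fixed [y], followed by choice, shows that the set from which [adj]
    selects is nonempty. *)
Lemma adjP (f : V -> V) : bounded_op ip f ->
  forall x y, '[f x, y] = '[x, adj ip f y].
Proof.
move=> [fL [M fM]].
suff [g gP] : exists g, forall x y, '[f x, y] = '[x, g y].
  have := @xgetPex _ f [set g | forall x y, '[f x, y] = '[x, g y]].
  by apply; exists g.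
suff H y : exists z, forall x, '[f x, y] = '[x, z].
  by have [g gP] := choice H; exists g => x y.
pose K := 1 + `|M|; have K0 : 0 < K by rewrite ltr_pwDl.
apply: (@riesz _ ((K * norm y) ^+ 2)) => [c x z|x].
  by rewrite fL ipDl ipZl.
(* The weights [K^-1] and [K] cancel in the inner product, and [K >= M] bounds the first square by
   [norm x ^+ 2], as the hypothesis of [riesz] demands. *)
have := re_amgm (K^-1%:C *: f x) (K%:C *: y).
rewrite reZl reC reZl reC !hnormZ !ger0_norm ?invr_ge0 ?(ltW K0) //.
rewrite (mulKf (lt0r_neq0 K0)) => /le_trans; apply; rewrite lerD2r.
rewrite ler_sqr ?nnegrE ?mulr_ge0 ?hnorm_ge0 ?invr_ge0 ?(ltW K0) //.
rewrite ler_pdivrMl //; apply: le_trans (fM x) _.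
by apply: ler_wpM2r; [exact: hnorm_ge0 | rewrite /K; have := ler_norm M; lra].
Qed.

End InnerProduct.

(** * Families of vectors, Gram matrices and the trace formula *)

Definition lc (R : realType) (V : lmodType R[i]) m n
    (f : 'I_m -> V) (A : 'M[R[i]]_(m, n)) : 'I_n -> V :=
  fun k => \sum_j A j k *: f j.

Lemma linop_lc (R : realType) (V : lmodType R[i]) m n (x : V -> V)
    (f : 'I_m -> V) (A : 'M_(m, n)) :
  linop x -> x \o lc f A = lc (x \o f) A.
Proof.
move=> xL; apply/funext => k; rewrite /= /lc.
rewrite (big_morph x (linopD xL) (linop0 xL)).
by apply: eq_bigr => j _; rewrite linopZ.
Qed.

Section Families.
Variables (R : realType) (V : lmodType R[i]) (ip : V -> V -> R[i]).
Hypothesis HV : is_hilbert ip.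
Local Notation C := R[i].
Local Notation "t %:C" := (real_complex R t).
Local Notation "'[ x , y ]" := (ip x y).
Local Notation re x y := (complex.Re (ip x y)).
Local Notation norm := (hnorm ip).

(* With a family f read as the operator e_j |-> f j from C^m to V, [cross f g]
   is the matrix of g^* f and [lc f A] is the composite f A. *)
Definition cross m n (f : 'I_m -> V) (g : 'I_n -> V) : 'M[C]_(n, m) :=
  \matrix_(i, j) '[f j, g i].

Lemma cross_lcl m n p (f : 'I_m -> V) (g : 'I_n -> V) (A : 'M_(m, p)) :
  cross (lc f A) g = cross f g *m A.
Proof.
apply/matrixP => i j; rewrite !mxE (ip_suml HV); apply: eq_bigr => k _.
by rewrite (ipZl HV) !mxE mulrC.
Qed.

Lemma cross_adj m n (f : 'I_m -> V) (g : 'I_n -> V) : (cross f g)^H = cross g f.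
Proof. by apply/matrixP => i j; rewrite !mxE [RHS](ipC HV). Qed.

Lemma cross_lcr m n p (f : 'I_m -> V) (g : 'I_n -> V) (A : 'M_(n, p)) :
  cross f (lc g A) = A^H *m cross f g.
Proof. by rewrite -cross_adj cross_lcl adjmxM cross_adj. Qed.

Lemma lc_lc m n p (f : 'I_m -> V) (A : 'M_(m, n)) (B : 'M_(n, p)) :
  lc (lc f A) B = lc f (A *m B).
Proof.
apply/funext => k; rewrite /lc.
under eq_bigr do rewrite scaler_sumr.
rewrite exchange_big; apply: eq_bigr => j _ /=.
rewrite mxE scaler_suml; apply: eq_bigr => i _.
by rewrite scalerA mulrC.
Qed.

Lemma lc1 m (f : 'I_m -> V) : lc f 1%:M = f.
Proof.
apply/funext => k; rewrite /lc (bigD1 k) //= mxE eqxx scale1r big1 ?addr0 //.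
by move=> j jk; rewrite mxE (negPf jk) scale0r.
Qed.

Lemma lcB m n (f : 'I_m -> V) (A B : 'M_(m, n)) k :
  lc f (A - B) k = lc f A k - lc f B k.
Proof.
by rewrite /lc -sumrB; apply: eq_bigr => j _; rewrite !mxE scalerBl.
Qed.

Lemma cross_psd m (f : 'I_m -> V) : psd (cross f f).
Proof.
split=> [|v]; first exact: cross_adj.
by rewrite -mulmxA -cross_lcl -cross_lcr mxE (ip_ge0 HV).
Qed.

Lemma cross0 m (f : 'I_m -> V) : cross f f = 0 -> f = fun=> 0.
Proof.
move=> f0; apply/funext => k; have /matrixP/(_ k k) := f0.
by rewrite !mxE => /(ip_eq0 HV).
Qed.

(* [cross W W] = W^* W is the initial projection of the partial isometry W. *)
Lemma polar m (u : 'I_m -> V) (P : 'M_m) : P^H = P -> P *m P = cross u u ->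
  exists W : 'I_m -> V, [/\ u = lc W P,
    (cross W W) *m (cross W W) = cross W W & P *m (cross W W) = P].
Proof.
move=> hP PP; have [Q [hQ PQ PQP]] := herm_pinv_exists hP.
have WE : cross (lc u Q) (lc u Q) = P *m Q.
  by rewrite cross_lcl cross_lcr hQ -PP mulmxA -PQ PQP.
exists (lc u Q); rewrite WE !mulmxA PQP; split=> //; last first.
  by rewrite -mulmxA PQ mulmxA.
rewrite lc_lc -[LHS]lc1; apply/funext => k; apply/eqP; rewrite -subr_eq0 -lcB.
(* The difference of [u] and [lc u (Q *m P)] vanishes because its Gram matrix contains the factor
   [P *m (1%:M - Q *m P) = 0]. *)
rewrite (@cross0 _ (lc u (1%:M - Q *m P))) //.
rewrite cross_lcl cross_lcr -PP -!mulmxA mulmxBr mulmx1.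
by rewrite [P *m (Q *m P)]mulmxA PQP subrr !mulmx0.
Qed.

(** The difference of the two matrices is the Gram matrix of the columns of [(1%:M - G) *m A]. This
    is how partial isometries act as contractions below. *)
Lemma tr_proj_le m n (A : 'M[C]_(m, n)) (G : 'M[C]_m) : G^H = G -> G *m G = G ->
  complex.Re (\tr (A^H *m G *m A)) <= complex.Re (\tr (A^H *m A)).
Proof.
move=> hG GG; apply: Re_le; rewrite -subr_ge0 -raddfB /=.
have -> : A^H *m A - A^H *m G *m A = ((1%:M - G) *m A)^H *m ((1%:M - G) *m A).
  have GG' : (1%:M - G) *m (1%:M - G) = 1%:M - G.
    by rewrite mulmxBr mulmx1 mulmxBl mul1mx GG subrr subr0.
  rewrite adjmxM adjmxB adjmx1 hG mulmxA -[A^H *m _ *m (_ - _)]mulmxA GG'.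
  by rewrite mulmxBr mulmx1 mulmxBl.
exact/psd_tr_ge0/adjmx_mul_psd.
Qed.

Lemma tr_cross m (f : 'I_m -> V) (g : 'I_m -> V) :
  \tr (cross f g) = \sum_k '[f k, g k].
Proof. by apply: eq_bigr => k _; rewrite mxE. Qed.

Lemma cross_conj m (P : 'M_m) (v : 'I_m -> V) : P^H = P ->
  P *m cross v v *m P = cross (lc v P) (lc v P).
Proof. by move=> hP; rewrite cross_lcl cross_lcr hP. Qed.

Lemma tgm_cross_ge0 m (u v : 'I_m -> V) : 0 <= tgm (cross u u) (cross v v).
Proof.
rewrite /tgm; have [/psd_herm hP _] := psd_sqrtP (cross_psd u).
rewrite cross_conj //.
have [/psd_tr_ge0/Re_le] := psd_sqrtP (cross_psd (lc v (psd_sqrt (cross u u)))).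
by [].
Qed.

Lemma tgm_upper m (u v : 'I_m -> V) (x : V -> V) : linop x ->
  (forall h, norm (x h) <= norm h) ->
  \sum_k re (x (v k)) (u k) <= tgm (cross u u) (cross v v).
Proof.
move=> xL xB; rewrite -Re_sum -(tr_cross (x \o v)) /tgm.
have [/psd_herm hP PP] := psd_sqrtP (cross_psd u).
move: (psd_sqrt (cross u u)) hP PP => P hP PP.
rewrite cross_conj //.
have [pM MM] := psd_sqrtP (cross_psd (lc v P)).
move: (psd_sqrt _) pM MM => M pM MM.
(* Splitting [M = N *m N] gives one factor [N] to each side of the inner product, so that a termwise
   arithmetic-geometric bound yields the sharp constant. *)
have [N [/psd_herm hN NN]] := psd_sqrt_exists pM.
have [W [uE WW PW]] := polar hP PP.
have [F [fE FF MF]] := polar (psd_herm pM) MM.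
(* Cyclicity of the trace moves [P] from [u = W P] over to [v], where [v P = F M]; the same device
   then moves one [N] back to [W]. *)
rewrite uE cross_lcr hP mxtrace_mulC -cross_lcl -linop_lc // fE -NN -lc_lc.
rewrite linop_lc // cross_lcl mxtrace_mulC -{1}hN -cross_lcr tr_cross Re_sum.
have H k : 2 * re (x (lc F N k)) (lc W N k) <=
    re (lc F N k) (lc F N k) + re (lc W N k) (lc W N k).
  apply: le_trans (re_amgm HV _ _) _; rewrite -!(sqr_hnorm HV) lerD2r.
  by rewrite ler_sqr ?nnegrE ?hnorm_ge0.
have trN (G : 'I_m -> V) : cross G G *m cross G G = cross G G ->
    \sum_k re (lc G N k) (lc G N k) <= complex.Re (\tr (N *m N)).
  move=> GG; rewrite -Re_sum -tr_cross cross_lcl cross_lcr hN.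
  by have := @tr_proj_le _ _ N _ (cross_adj G G) GG; rewrite hN.
have := trN F FF; have := trN W WW; rewrite NN => HW HF.
have : \sum_k 2 * re (x (lc F N k)) (lc W N k) <=
    \sum_k (re (lc F N k) (lc F N k) + re (lc W N k) (lc W N k)).
  by apply: ler_sum => k _; apply: H.
by rewrite big_split /= -mulr_sumr; lra.
Qed.

Lemma tgm_attained m (u v : 'I_m -> V) : exists x : V -> V, [/\ linop x,
  (forall h, norm (x h) <= norm h) &
  \sum_k re (x (v k)) (u k) = tgm (cross u u) (cross v v)].
Proof.
rewrite /tgm.
have [/psd_herm hP PP] := psd_sqrtP (cross_psd u).
move: (psd_sqrt (cross u u)) hP PP => P hP PP.
rewrite cross_conj //.
have [/psd_herm hM MM] := psd_sqrtP (cross_psd (lc v P)).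
move: (psd_sqrt _) hM MM => M hM MM.
have [W [uE WW PW]] := polar hP PP.
have [F [fE FF MF]] := polar hM MM.
(* This is [W] composed with the adjoint of [F]. *)
pose x h := \sum_k '[h, F k] *: W k.
have xL : linop x.
  move=> c h h'; rewrite /x scaler_sumr -big_split; apply: eq_bigr => k _ /=.
  by rewrite (ipDl HV) (ipZl HV) scalerDl scalerA.
exists x; split=> // [h|].
  (* [c] is the adjoint of [F] applied to [h]. Then [2 |c|^2 = 2 Re <h, F c> <= |h|^2 + |F c|^2 <=
     |h|^2 + |c|^2], so [|x h| = |W c| <= |c| <= |h|]. *)
  pose c := cross (fun _ : 'I_1 => h) F.
  have re1 (f g : 'I_1 -> V) : re (f 0) (g 0) = complex.Re (\tr (cross f g)).
    by rewrite tr_cross big_ord1.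
  have norm1 (G : 'I_m -> V) : cross G G *m cross G G = cross G G ->
      norm (lc G c 0) ^+ 2 <= complex.Re (\tr (c^H *m c)).
    move=> GG; rewrite (sqr_hnorm HV) re1 cross_lcl cross_lcr.
    exact: tr_proj_le (cross_adj _ _) GG.
  have xE : x h = lc W c 0 by apply: eq_bigr => k _; rewrite mxE.
  have := re_amgm HV h (lc F c 0).
  rewrite (re1 (fun=> h)) cross_lcr -/c => amgm.
  rewrite -ler_sqr ?nnegrE ?hnorm_ge0 // xE; apply: le_trans (norm1 W WW) _.
  by have := norm1 F FF; lra.
rewrite -Re_sum -(tr_cross (x \o v)); congr complex.Re.
rewrite uE cross_lcr hP mxtrace_mulC -cross_lcl -linop_lc // fE linop_lc //.
have -> : x \o F = lc W (cross F F).
  by apply/funext => k; rewrite /= /x /lc; apply: eq_bigr => j _; rewrite mxE.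
rewrite cross_lcl cross_lcl -mulmxA.
have -> : cross F F *m M = M by rewrite -[LHS]adjmxK adjmxM cross_adj hM MF hM.
suff -> : cross W W *m M = M by [].
rewrite -[LHS]adjmxK adjmxM cross_adj hM.
(* The initial projection of [W] fixes [M], since [M *m M] ends in the factor [P] and [P]
   annihilates [1%:M - cross W W]. *)
suff /eqP : M *m (1%:M - cross W W) = 0.
  by rewrite mulmxBr mulmx1 subr_eq0 => /eqP <-.
apply: adjmx_mul_eq0; rewrite adjmxM hM -mulmxA [M *m (M *m _)]mulmxA MM.
rewrite cross_lcl -mulmxA [P *m (_ - _)]mulmxBr mulmx1 PW subrr.
by rewrite !mulmx0.
Qed.

End Families.

(** * Contractions, elementary operators and the norm formula *)

Section ElementaryOperators.
Variables (R : realType) (V : lmodType R[i]) (ip : V -> V -> R[i]).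
Hypothesis HV : is_hilbert ip.
Local Notation "t %:C" := (real_complex R t).
Local Notation re x y := (complex.Re (ip x y)).
Local Notation norm := (hnorm ip).

Lemma normalize v : v <> 0 -> exists2 w, norm w = 1 & v = (norm v)%:C *: w.
Proof.
move=> v0; have nv : norm v != 0 by apply/eqP => /(hnorm_eq0 HV).
exists ((norm v)^-1%:C *: v).
  by rewrite (hnormZ HV) ger0_norm ?invr_ge0 ?hnorm_ge0 // mulVf.
by rewrite scalerA -rmorphM divff // scale1r.
Qed.

Lemma opnorm_le1P x : bounded_op ip x -> (opnorm ip x <= 1%:E)%E ->
  forall h, norm (x h) <= norm h.
Proof.
move=> [xL _] x1 h; have [->|/eqP h0] := eqVneq h 0.
  by rewrite (linop0 xL).
have [w w1 ->] := normalize h0.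
rewrite (linopZ xL) !(hnormZ HV) w1 ler_wpM2l //.
rewrite -lee_fin; apply: le_trans x1; apply: ereal_sup_ubound.
by exists w => //=; rewrite w1.
Qed.

Lemma contraction_opnorm x : linop x -> (forall h, norm (x h) <= norm h) ->
  bounded_op ip x /\ (opnorm ip x <= 1%:E)%E.
Proof.
move=> xL x1; split; first by split=> //; exists 1 => h; rewrite mul1r.
by apply: ge_ereal_sup => _ [v /= v1 <-]; rewrite lee_fin (le_trans (x1 v)).
Qed.

Variables (l : nat) (a b : 'I_l -> V -> V).
Hypothesis Ha : forall j, bounded_op ip (a j).
Hypothesis Hb : forall j, bounded_op ip (b j).

Lemma re_elem_op x xi eta :
  re (elem_op a b x eta) xi = \sum_j re (x (b j eta)) (adj ip (a j) xi).
Proof.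
by rewrite (ip_suml HV) Re_sum; apply: eq_bigr => j _; rewrite (adjP HV (Ha j)).
Qed.

Lemma elem_opZ x c v : linop x -> elem_op a b x (c *: v) = c *: elem_op a b x v.
Proof.
move=> xL; rewrite /elem_op scaler_sumr; apply: eq_bigr => j _.
by rewrite (linopZ (Hb j).1) (linopZ xL) (linopZ (Ha j).1).
Qed.

End ElementaryOperators.

Unset Implicit Arguments.

Theorem theorem1p4 (R : realType) (V : lmodType R[i]) (ip : V -> V -> R[i])
  (HV : is_hilbert ip) (Hnt : exists v : V, v <> 0)
  (l : nat) (a b : 'I_l -> V -> V)
  (Ha : forall j, bounded_op ip (a j)) (Hb : forall j, bounded_op ip (b j)) :
  elem_norm ip a b =
  ereal_sup [set t : \bar R | exists xi eta : V,
     [/\ hnorm ip xi = 1, hnorm ip eta = 1 &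
        t = (tgm (Qmx ip (fun j => adj ip (a j)) xi) (Qmx ip b eta))%:E]].
Proof.
set S := ereal_sup _.
have tgm_le_S xi eta : hnorm ip xi = 1 -> hnorm ip eta = 1 ->
    ((tgm (Qmx ip (fun j => adj ip (a j)) xi) (Qmx ip b eta))%:E <= S)%E.
  by move=> xi1 eta1; apply: ereal_sup_ubound; exists xi, eta.
have [v0 /(normalize HV)[e e1 _]] := Hnt.
(* A unit vector exists, so the supremum is not the [-oo] of an empty set; this settles the cases
   where [v] or [elem_op a b x eta] is zero. *)
have S0 : (0 <= S)%E.
  apply: le_trans (tgm_le_S e e e1 e1); rewrite lee_fin.
  exact: tgm_cross_ge0.
apply/eqP; rewrite eq_le; apply/andP; split; apply: ge_ereal_sup.
- move=> _ [x [xB x1] <-]; apply: ge_ereal_sup => _ [v /= v1 <-].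
  have xL := xB.1; have xC := opnorm_le1P HV xB x1.
  have [->|/eqP nv] := eqVneq v 0.
    by rewrite -(scale0r v0) (elem_opZ Ha Hb) // scale0r (hnorm0 HV).
  have [eta eta1 vE] := normalize HV nv.
  have -> : elem_op a b x v = real_complex R (hnorm ip v) *: elem_op a b x eta.
    by rewrite {1}vE (elem_opZ Ha Hb).
  rewrite (hnormZ HV) ger0_norm ?hnorm_ge0 //.
  apply: (@le_trans _ _ (hnorm ip (elem_op a b x eta))%:E).
    by rewrite lee_fin ler_piMl ?hnorm_ge0.
  have [->|/eqP nT] := eqVneq (elem_op a b x eta) 0.
    by rewrite (hnorm0 HV).
  (* Pairing [elem_op a b x eta] with its own direction [xi] recovers its norm as a real part. *)
  have [xi xi1 TE] := normalize HV nT.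
  apply: le_trans (tgm_le_S xi eta xi1 eta1); rewrite lee_fin.
  apply: le_trans (tgm_upper HV _ _ xL xC).
  rewrite -(re_elem_op HV b Ha) [in leRHS]TE (reZl HV) -(sqr_hnorm HV) xi1.
  by rewrite expr1n mulr1.
- move=> _ [xi [eta [xi1 eta1 ->]]].
  (* [Qmx] unfolds to [cross] of a family with itself, so the extremal contraction for these two
     families tests the norm. *)
  have [x [xL xC tgmE]] := tgm_attained HV (fun j => adj ip (a j) xi) (b^~ eta).
  have xB := contraction_opnorm xL xC.
  apply: (@le_trans _ _ (opnorm ip (elem_op a b x))); last first.
    by apply: ereal_sup_ubound; exists x.
  apply: (@le_trans _ _ (hnorm ip (elem_op a b x eta))%:E); last first.
    by apply: ereal_sup_ubound; exists eta => //=; rewrite eta1.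
  rewrite lee_fin -[X in X <= _]tgmE -(re_elem_op HV b Ha).
  by rewrite (le_trans (re_cauchy HV _ _)) // xi1 mulr1.
Qed.
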